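(* Let $n\ge 4$ and let $\Gamma$ be a connected simple graph of order $n$ with exactly one bridge. Then \[ SO(\Gamma)\ge 2(n-3)\sqrt{2}+\sqrt{10}+2\sqrt{13}, \] with equality if and only if $\Gamma\cong \mathbb{P}_n^1$.
   Context: The Sombor index of a graph $\Gamma$ is $SO(\Gamma)=\sum_{uv\in E(\Gamma)}\sqrt{\deg_\Gamma(u)^2+\deg_\Gamma(v)^2}$. A bridge is an edge whose deletion disconnects the graph. $\mathbb{P}_n^1$ is the graph obtained from the cycle $C_{n-1}$ by adding one new vertex adjacent to exactly one vertex of the cycle. *)

(* Defs.v *)
From HB Require Import structures.
From mathcomp Require Import all_boot all_order all_algebra.

Set Implicit Arguments.
Unset Strict Implicit.
Unset Printing Implicit Defensive.

Import Order.TTheory GRing.Theory Num.Theory.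

Record sgraph (V : finType) := SGraph {
  adj :> rel V;
  adj_sym : symmetric adj;
  adj_irrefl : irreflexive adj }.

Section Graphs.

Variable V : finType.
Implicit Types (G : sgraph V) (A : {set V}).

(* Edges are the two-element sets of adjacent vertices. *)
Definition edges G : {set {set V}} :=
  [set A | [exists x, exists y, G x y && (A == [set x; y])]].

Definition deg G (x : V) : nat := #|[set y | G x y]|.

Definition connected G : bool := [forall x, forall y, connect G x y].

Definition del_edge_rel G A : rel V :=
  fun x y => G x y && ([set x; y] != A).

Lemma del_edge_sym G A : symmetric (del_edge_rel G A).
Proof. by move=> x y; rewrite /del_edge_rel adj_sym setUC. Qed.

Lemma del_edge_irrefl G A : irreflexive (del_edge_rel G A).
Proof. by move=> x; rewrite /del_edge_rel adj_irrefl. Qed.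

Definition del_edge G A : sgraph V :=
  SGraph (del_edge_sym G A) (del_edge_irrefl G A).

(* Meant for connected G. *)
Definition bridge G A : bool :=
  (A \in edges G) && ~~ connected (del_edge G A).

Definition bridges G : {set {set V}} := [set A | bridge G A].

(* An edge uv is the set A = [set u; v], so the inner sum is
   deg u ^ 2 + deg v ^ 2; see edge_weightE. *)
Definition sombor (R : rcfType) G : R :=
  (\sum_(A in edges G) Num.sqrt (\sum_(x in A) (deg G x)%:R ^+ 2))%R.

Lemma edge_weightE (R : rcfType) G u v : G u v ->
  (\sum_(x in [set u; v]) (deg G x)%:R ^+ 2
   = (deg G u)%:R ^+ 2 + (deg G v)%:R ^+ 2 :> R)%R.
Proof.
move=> Guv; rewrite big_setU1 ?big_set1 // inE.
by apply: contraTneq Guv => ->; rewrite adj_irrefl.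
Qed.

Definition add_pendant_rel G (v : V) : rel (option V) := fun x y =>
  match x, y with
  | Some a, Some b => G a b
  | Some a, None => a == v
  | None, Some b => b == v
  | None, None => false
  end.

Lemma add_pendant_sym G v : symmetric (add_pendant_rel G v).
Proof. by move=> [a|] [b|] //=; rewrite adj_sym. Qed.

Lemma add_pendant_irrefl G v : irreflexive (add_pendant_rel G v).
Proof. by move=> [a|] //=; rewrite adj_irrefl. Qed.

Definition add_pendant G v : sgraph (option V) :=
  SGraph (add_pendant_sym G v) (add_pendant_irrefl G v).

End Graphs.

Arguments sombor {V} R G.

Definition graph_iso (V W : finType) (G : sgraph V) (H : sgraph W) : Prop :=
  exists2 f : V -> W, bijective f & forall x y, H (f x) (f y) = G x y.

Definition cycle_rel (m : nat) : rel 'I_m := fun i j =>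
  (i != j) && ((j == i.+1 %[mod m]) || (i == j.+1 %[mod m])).

Lemma cycle_sym m : symmetric (@cycle_rel m).
Proof. by move=> i j; rewrite /cycle_rel eq_sym orbC. Qed.

Lemma cycle_irrefl m : irreflexive (@cycle_rel m).
Proof. by move=> i; rewrite /cycle_rel eqxx. Qed.

(* The cycle C_m when m >= 3. *)
Definition cycle_graph m : sgraph 'I_m :=
  SGraph (@cycle_sym m) (@cycle_irrefl m).

(* P_n^1; here n.-2.+1 = n - 1 for n >= 2, a form for which ord0 exists. *)
Definition P1 (n : nat) : sgraph (option 'I_n.-2.+1) :=
  add_pendant (cycle_graph n.-2.+1) ord0.

(* Main.v *)
(* An edge is a bridge unless it lies on a simple cycle, and then both of its
   ends have two neighbors along that cycle.  Hence a vertex incident to some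
   non-bridge has degree at least 2, and at least 3 if it is also incident to a
   bridge.  By connectedness some end v of the unique bridge uv has a further
   neighbor, so the degrees dominate those of P_n^1 pointwise, and by the
   handshake lemma there are at least n edges, with equality iff the degrees are
   those of P_n^1.  In that case a simple cycle through v has no room for
   further edges except uv, so it covers everything but u and G is P_n^1.

   In the Sombor index, the bridge weighs at least sqrt 10, the other
   deg v - 1 >= 2 edges at v at least sqrt 13, and all remaining ones at least
   sqrt 8.  So the index of G is at least that of P_m^1 for m = #|edges G| >= n,
   and the latter increases with m. *)

Require Import Defs.
From HB Require Import structures.
From mathcomp Require Import all_boot all_order all_algebra.
From mathcomp Require Import zify ring.

Set Implicit Arguments.
Unset Strict Implicit.
Unset Printing Implicit Defensive.

Import Order.TTheory GRing.Theory Num.Theory.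

Lemma set2_injr (T : finType) (x : T) : injective (fun y => [set x; y]).
Proof.
move=> y z eq_xy_xz; have: y \in [set x; z] by rewrite -eq_xy_xz set22.
have: z \in [set x; y] by rewrite eq_xy_xz set22.
by rewrite !inE => /orP[] /eqP-> // /orP[] /eqP.
Qed.

Lemma imset_set2 (T U : finType) (f : T -> U) (x y : T) :
  f @: [set x; y] = [set f x; f y].
Proof. by rewrite imsetU1 imset_set1. Qed.

Lemma next_neq_prev (T : eqType) (s : seq T) (x : T) :
  uniq s -> 2 < size s -> x \in s -> next s x != prev s x.
Proof.
move=> s_uniq s2 xs; have [i p s_def] := rot_to xs.
rewrite -(next_rot i) // -(prev_rot i) // s_def.
move: s_uniq s2; rewrite -(rot_uniq i) -(size_rot i) s_def.
case: p {s_def} => [|y [|z p]] // /and3P[xyzp yzp _] _.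
rewrite prev_nth mem_head memNindex //= eqxx.
rewrite -[nth _ _ _]/(nth x (z :: p) (size (z :: p)).-1) nth_last /=.
by apply: contraNneq yzp => ->; apply: mem_last.
Qed.

Lemma cycle_nth (T : Type) (e : rel T) (s : seq T) (x0 : T) (i : nat) :
  cycle e s -> i < size s -> e (nth x0 s i) (nth x0 s (i.+1 %% size s)).
Proof.
case: s => [|x p] // /(pathP x0) p_adj lt_i.
have := p_adj i; rewrite size_rcons => /(_ lt_i).
rewrite -rcons_cons !nth_rcons lt_i; have [->|ne_ip] := eqVneq i (size p).
  by rewrite ltnn modnn.
have lt_ip : i < size p by rewrite ltn_neqAle ne_ip -ltnS.
by rewrite lt_ip modn_small.
Qed.

Lemma iter_ordS_neq m k (i : 'I_m) : 0 < k < m -> iter k (@ordS m) i != i.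
Proof.
case/andP=> k0 km; have valE : val (iter k (@ordS m) i) = (i + k) %% m.
  elim: k {k0 km} => [|k IHk]; first by rewrite addn0 modn_small.
  by rewrite iterS /= IHk -addn1 modnDml addn1 addnS.
rewrite -val_eqE valE -[X in _ == X](modn_small (ltn_ord i)).
by rewrite -[X in _ == X %% _]addn0 eqn_modDl mod0n modn_small // -lt0n.
Qed.

Definition neighbors (V : finType) (G : sgraph V) (x : V) : {set V} :=
  [set y | G x y].

Section Edges.

Variables (V : finType) (G : sgraph V).
Implicit Types (x y z : V) (A : {set V}).

Lemma in_neighbors x y : (y \in neighbors G x) = G x y.
Proof. exact: in_set. Qed.

Lemma card_neighbors x : #|neighbors G x| = deg G x.
Proof. by []. Qed.

Lemma deg_gt0 x y : G x y -> 0 < deg G x.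
Proof. by move=> Gxy; apply/card_gt0P; exists y; rewrite inE. Qed.

Lemma adj_neq x y : G x y -> x != y.
Proof. by apply: contraTneq => ->; rewrite adj_irrefl. Qed.

Lemma adj_connect_sym : connect_sym G.
Proof. exact/sym_connect_sym/adj_sym. Qed.

Lemma edgesP A :
  reflect (exists x y, G x y /\ A = [set x; y]) (A \in edges G).
Proof.
rewrite inE; apply: (iffP existsP) => [[x /existsP[y /andP[Gxy /eqP->]]]|].
  by exists x, y.
by case=> x [y [Gxy ->]]; exists x; apply/existsP; exists y; rewrite Gxy eqxx.
Qed.

Lemma mem_edges x y : ([set x; y] \in edges G) = G x y.
Proof.
apply/edgesP/idP => [[a [b [Gab eq_xy_ab]]]|Gxy]; last by exists x, y.
have: x \in [set a; b] by rewrite -eq_xy_ab set21.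
rewrite !inE => /orP[] /eqP x_def; rewrite {}x_def in eq_xy_ab *.
  by rewrite (set2_injr eq_xy_ab).
by rewrite [RHS]setUC in eq_xy_ab; rewrite (set2_injr eq_xy_ab) adj_sym.
Qed.

Lemma edges_offP x A : reflect
    (exists y z, [/\ G y z, y != x, z != x & A = [set y; z]])
  (A \in [set A in edges G | x \notin A]).
Proof.
apply: (iffP setIdP) => [[/edgesP[y [z [Gyz ->]]]]|[y [z [Gyz yx zx ->]]]].
  by rewrite !inE negb_or ![x == _]eq_sym => /andP[]; exists y, z.
by rewrite mem_edges !inE negb_or ![x == _]eq_sym yx.
Qed.

Lemma edges_at x :
  [set A in edges G | x \in A] = [set [set x; y] | y in neighbors G x].
Proof.
apply/setP=> A; apply/setIdP/imsetP => [[/edgesP[a [b [Gab ->]]]]|[y]].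
  rewrite !inE => /orP[] /eqP->; first by exists b; rewrite ?inE.
  by exists a; rewrite ?inE 1?adj_sym // setUC.
by rewrite in_neighbors -mem_edges => Exy ->; rewrite set21.
Qed.

Lemma big_edges_at (R : Type) (idx : R) (op : Monoid.com_law idx)
    (F : {set V} -> R) x :
  \big[op/idx]_(A in edges G | x \in A) F A =
  \big[op/idx]_(y in neighbors G x) F [set x; y].
Proof.
rewrite -(big_imset F (h := fun y => [set x; y])); last first.
  by move=> y z _ _ /set2_injr.
by rewrite -edges_at; apply: eq_bigl => A; rewrite !inE.
Qed.

Lemma card_edges_at x : #|[set A in edges G | x \in A]| = deg G x.
Proof. by rewrite edges_at card_imset //; apply: set2_injr. Qed.

Lemma leq_deg_card_edges x : deg G x <= #|edges G|.
Proof.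
by rewrite -card_edges_at subset_leq_card //; apply/subsetP=> A /setIdP[].
Qed.

Lemma card_edges_off x :
  #|[set A in edges G | x \notin A]| = #|edges G| - deg G x.
Proof.
rewrite -(cardsID [set A : {set V} | x \in A] (edges G)) -setIdE.
by rewrite card_edges_at addKn; apply: eq_card => A; rewrite !inE andbC.
Qed.

Lemma sum_deg : \sum_x deg G x = 2 * #|edges G|.
Proof.
transitivity (\sum_x \sum_(A in edges G | x \in A) 1).
  by apply: eq_bigr => x _; rewrite big_edges_at sum1_card.
rewrite (exchange_big_dep [in edges G]) /=; last by move=> ? ? _ /andP[].
rewrite mulnC -sum_nat_const; apply: eq_bigr => A EA.
under eq_bigl => x do rewrite EA /=.
rewrite sum1_card; case/edgesP: EA => x [y [Gxy ->]].
by rewrite cards2 (adj_neq Gxy).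
Qed.

Lemma neighbors_eq x A :
  A \subset neighbors G x -> deg G x <= #|A| -> neighbors G x = A.
Proof.
by move=> AN leA; apply/esym/eqP; rewrite eqEcard AN card_neighbors.
Qed.

Lemma pendant_adj x y z : deg G x = 1 -> G x y -> G x z -> y = z.
Proof.
move=> deg_x Gxy Gxz; have: z \in neighbors G x by rewrite in_neighbors.
rewrite (@neighbors_eq x [set y]) ?sub1set ?in_neighbors ?cards1 ?deg_x //.
by move/set1P.
Qed.

End Edges.

Section Homomorphisms.

Variables (V W : finType) (G : sgraph V) (H : sgraph W).

Lemma graph_iso_sym : graph_iso G H -> graph_iso H G.
Proof.
case=> f [g fK gK] fG; exists g; first by exists f.
by move=> x y; rewrite -fG !gK.
Qed.

Variable f : V -> W.
Hypotheses (f_inj : injective f) (f_hom : forall x y, G x y -> H (f x) (f y)).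

Lemma imset_edges_sub : [set f @: A | A : {set V} in edges G] \subset edges H.
Proof.
apply/subsetP=> _ /imsetP[_ /edgesP[x [y [Gxy ->]]] ->].
by rewrite imset_set2 mem_edges f_hom.
Qed.

Lemma hom_leq_card_edges : #|edges G| <= #|edges H|.
Proof.
by rewrite -(card_imset _ (imset_inj f_inj)) subset_leq_card ?imset_edges_sub.
Qed.

Lemma bij_hom_iso : #|W| <= #|V| -> #|edges H| <= #|edges G| -> graph_iso G H.
Proof.
move=> leWV leHG; exists f; first exact: inj_card_bij.
have imset_edges : [set f @: A | A : {set V} in edges G] = edges H.
  by apply/eqP; rewrite eqEcard imset_edges_sub card_imset //; apply: imset_inj.
move=> x y; rewrite -mem_edges -imset_edges -imset_set2.
by rewrite mem_imset ?mem_edges //; apply: imset_inj.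
Qed.

End Homomorphisms.

Lemma graph_iso_card_edges (V W : finType) (G : sgraph V) (H : sgraph W) :
  graph_iso G H -> #|edges G| = #|edges H|.
Proof.
have le_edges V1 V2 (G1 : sgraph V1) (G2 : sgraph V2) :
    graph_iso G1 G2 -> #|edges G1| <= #|edges G2|.
  case=> f /bij_inj f_inj fG.
  by apply: (hom_leq_card_edges f_inj) => x y; rewrite fG.
by move=> iso; apply/eqP; rewrite eqn_leq !le_edges //; apply: graph_iso_sym.
Qed.

Section AddPendant.

Variables (V : finType) (G : sgraph V) (v : V).

Lemma deg_add_pendant_None : deg (add_pendant G v) None = 1.
Proof.
rewrite -(cards1 (Some v)) -card_neighbors.
by apply: eq_card => -[a|]; rewrite !inE.
Qed.

Lemma deg_add_pendant_Some a :
  deg (add_pendant G v) (Some a) = (a == v) + deg G a.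
Proof.
rewrite -!card_neighbors (cardsD1 None) in_neighbors; congr (_ + _).
rewrite -[RHS](card_imset _ Some_inj); apply: eq_card => -[b|]; rewrite !inE.
  by rewrite mem_imset ?inE //; apply: Some_inj.
by apply/esym/imsetP => -[].
Qed.

Lemma card_edges_add_pendant : #|edges (add_pendant G v)| = #|edges G|.+1.
Proof.
apply: double_inj; rewrite -!mul2n -sum_deg (bigD1 None) //=.
rewrite (reindex_omap Some id) => [|[]] //=.
under eq_bigl => a do rewrite eqxx.
under eq_bigr => a _ do rewrite deg_add_pendant_Some.
rewrite big_split sum_deg /= -big_mkcond /= big_pred1_eq.
by rewrite deg_add_pendant_None; lia.
Qed.

End AddPendant.

Lemma deg_cycle_graph m (i : 'I_m) : 2 < m -> deg (cycle_graph m) i = 2.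
Proof.
move=> m2; have adjE j : cycle_graph m i j = (j == ordS i) || (j == ord_pred i).
  rewrite /= /cycle_rel (modn_small (ltn_ord i)) (modn_small (ltn_ord j)).
  rewrite -(can_eq (@ordSK m) j (ord_pred i)) ord_predK [_ == i]eq_sym.
  rewrite -!val_eqE /=.
  case: eqP => //= ij; apply/esym/negbTE; rewrite -(val_inj ij) negb_or.
  have := @iter_ordS_neq m 1 i; rewrite -val_eqE eq_sym /= => -> //.
  by rewrite ltnW.
have nbrsE : neighbors (cycle_graph m) i = [set ordS i; ord_pred i].
  by apply/setP=> j; rewrite in_neighbors adjE !inE.
rewrite -card_neighbors nbrsE cards2 -(can_eq (@ordSK m)) ord_predK.
by have -> := @iter_ordS_neq m 2 i m2.
Qed.

Lemma card_edges_cycle_graph m : 2 < m -> #|edges (cycle_graph m)| = m.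
Proof.
move=> m2; apply: double_inj; rewrite -!mul2n -sum_deg mulnC.
under eq_bigr => i _ do rewrite deg_cycle_graph //.
by rewrite sum_nat_const card_ord.
Qed.

Lemma card_edges_P1 n : 3 < n -> #|edges (P1 n)| = n.
Proof.
by move=> n3; rewrite card_edges_add_pendant card_edges_cycle_graph; lia.
Qed.

Section SimpleCycles.

Variables (V : finType) (G : sgraph V).
Implicit Types (x y z : V) (s : seq V).

(* Without the bound on the size, [:: x; y] would be a cycle for any edge xy. *)
Definition simple_cycle s := [&& uniq s, cycle G s & 2 < size s].

Lemma simple_cycle_rot n s : simple_cycle (rot n s) = simple_cycle s.
Proof. by rewrite /simple_cycle rot_uniq rot_cycle size_rot. Qed.

Lemma card_cycle_neighbors s x :
  simple_cycle s -> x \in s -> #|[set next s x; prev s x]| = 2.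
Proof. by case/and3P=> s_uniq _ s2 xs; rewrite cards2 next_neq_prev. Qed.

Lemma cycle_neighbors s x :
  simple_cycle s -> x \in s -> [set next s x; prev s x] \subset neighbors G x.
Proof.
case/and3P=> _ s_cyc _ xs; apply/subsetP=> y; rewrite !inE => /orP[]/eqP->.
  exact: next_cycle.
by rewrite adj_sym prev_cycle.
Qed.

Lemma cycle_graph_hom m s x0 (i j : 'I_m) :
  cycle G s -> size s = m -> cycle_graph m i j -> G (nth x0 s i) (nth x0 s j).
Proof.
move=> s_adj size_s /andP[_].
have s_nth (k : 'I_m) : G (nth x0 s k) (nth x0 s (k.+1 %% m)).
  by rewrite -[X in _ %% X]size_s; apply: cycle_nth; rewrite ?size_s.
rewrite (modn_small (ltn_ord i)) (modn_small (ltn_ord j)).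
by case/orP=> /eqP->; last rewrite adj_sym; apply: s_nth.
Qed.

End SimpleCycles.

Section Bridges.

Variables (V : finType) (G : sgraph V).
Hypothesis G_conn : connected G.
Implicit Types (x y z : V) (A : {set V}) (s : seq V).

Lemma connected_connect x y : connect G x y.
Proof. by move/forallP: G_conn => /(_ x)/forallP. Qed.

Lemma connected_closed A x :
  x \in A -> (forall y z, G y z -> y \in A -> z \in A) -> A = setT.
Proof.
move=> xA clA; apply/setP=> y; rewrite inE.
have A_closed : closed G [in A].
  by apply: intro_closed => [|a b]; [apply: adj_connect_sym | apply: clA].
by rewrite -(closed_connect A_closed (connected_connect x y)).
Qed.

Lemma connected_exit A x :
  x \in A -> #|A| < #|V| -> exists y z, [/\ y \in A, z \notin A & G y z].
Proof.
move=> xA; rewrite ltnNge => /negP ltAV.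
case: (boolP [exists y in A, exists z, G y z && (z \notin A)]).
  by case/exists_inP=> y yA /existsP[z /andP[Gyz zA]]; exists y, z.
move/exists_inPn=> noexit; case: ltAV.
rewrite (@connected_closed A x) ?cardsT // => y z Gyz /noexit/existsPn/(_ z).
by rewrite Gyz negbK.
Qed.

Lemma bridgeE x y : G x y ->
  bridge G [set x; y] = ~~ connect (del_edge G [set x; y]) x y.
Proof.
move=> Gxy; rewrite /bridge mem_edges Gxy /=; congr (~~ _).
apply/idP/idP => [/forallP/(_ x)/forallP //|cxy].
apply/forallP=> a; apply/forallP=> b.
apply: (connect_sub _ (connected_connect a b)) => {a b} a b Gab.
have [/= eq_ab_xy|ne] := eqVneq [set a; b] [set x; y]; last first.
  by apply: connect1; rewrite /= /del_edge_rel Gab.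
have: a \in [set x; y] by rewrite -eq_ab_xy set21.
rewrite !inE => /orP[] /eqP a_def; rewrite {}a_def in eq_ab_xy *.
  by rewrite (set2_injr eq_ab_xy).
move: eq_ab_xy; rewrite [RHS]setUC => /set2_injr ->.
by rewrite (adj_connect_sym (del_edge G [set x; y])).
Qed.

Lemma cycle_edge_not_bridge s x :
  simple_cycle G s -> x \in s -> ~~ bridge G [set x; next s x].
Proof.
move=> s_cycle xs; have [s_uniq s_adj _] := and3P s_cycle.
rewrite bridgeE; last exact: next_cycle s_adj xs.
have [i [|y q] s_def] := rot_to xs; move: s_cycle.
  by rewrite -(simple_cycle_rot G i) s_def => /and3P[].
rewrite -(simple_cycle_rot G i) -(next_rot i) // s_def [next _ _]/= eqxx negbK.
case/and3P=> /andP[x_yq /andP[y_q _]] xyq_cycle q_size.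
have: G x y && path G y (rcons q x) := xyq_cycle.
rewrite rcons_path => /and3P[_ q_path q_last].
rewrite adj_connect_sym.
apply/connectP; exists (rcons q x); last by rewrite last_rcons.
rewrite rcons_path /= /del_edge_rel q_last /=; apply/andP; split; last first.
  rewrite setUC; apply: contraNneq y_q => /set2_injr.
  case: q q_size {s_def x_yq xyq_cycle q_path q_last} => //= z p _ <-.
  exact: mem_last.
apply: (sub_in_path (P := predC1 x)) q_path => [a b ax bx Gab|].
  apply/andP; split=> //; apply: contraTneq (set21 x y) => <-.
  by rewrite !inE ![x == _]eq_sym (negPf ax) (negPf bx).
by apply/allP=> a a_yq; apply: contraNneq x_yq => <-.
Qed.

Lemma not_bridge_cycle x y : G x y -> ~~ bridge G [set x; y] ->
  exists s, [/\ simple_cycle G s, x \in s & y = next s x].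
Proof.
move=> Gxy; have Gyx : G y x by rewrite adj_sym.
rewrite setUC bridgeE // negbK => /connectP[p0 p0_path x_def].
move: x_def; case/shortenP: p0_path => p p_path p_uniq _ x_def.
have path_G : path G y p by apply: sub_path p_path => a b /andP[].
exists (y :: p); split; last first.
- by rewrite next_nth x_def mem_last index_last // nth_default.
- by rewrite x_def mem_last.
apply/and3P; split=> //; first by rewrite /= rcons_path path_G -x_def.
case: p p_path x_def {p_uniq path_G} => [|a [|b p]] //=.
  by move=> _ x_def; rewrite x_def adj_irrefl in Gxy.
by rewrite /del_edge_rel andbT => /andP[_] /[swap] ->; rewrite eqxx.
Qed.

Lemma not_bridge_deg_gt1 x y : G x y -> ~~ bridge G [set x; y] -> 1 < deg G x.
Proof.
move=> Gxy /(not_bridge_cycle Gxy)[s [s_cycle xs _]].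
have /subset_leq_card := cycle_neighbors s_cycle xs.
by rewrite (card_cycle_neighbors s_cycle).
Qed.

Lemma bridge_not_bridge_deg_gt2 x y z :
  bridge G [set x; y] -> G x z -> ~~ bridge G [set x; z] -> 2 < deg G x.
Proof.
move=> br_xy Gxz /(not_bridge_cycle Gxz)[s [s_cycle xs _]].
have y_off : y \notin [set next s x; prev s x].
  rewrite !inE; apply: contraTN br_xy => /orP[]/eqP->.
    exact: cycle_edge_not_bridge.
  rewrite setUC -[X in [set _; X]](@next_prev _ s); last by case/and3P: s_cycle.
  by rewrite cycle_edge_not_bridge ?mem_prev.
have Gxy : G x y by rewrite -mem_edges; case/andP: br_xy.
have y_cycle_nbrs : y |: [set next s x; prev s x] \subset neighbors G x.
  by rewrite subUset sub1set in_neighbors Gxy cycle_neighbors.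
rewrite -card_neighbors (leq_trans _ (subset_leq_card y_cycle_nbrs)) //.
by rewrite cardsU1 y_off (card_cycle_neighbors s_cycle).
Qed.

End Bridges.

(* The degrees of P_n^1, when u is its pendant vertex, attached at v. *)
Definition pan_deg (T : eqType) (u v x : T) : nat :=
  if x == u then 1 else if x == v then 3 else 2.

Lemma pan_deg_pendant (T : eqType) (u v : T) : pan_deg u v u = 1.
Proof. by rewrite /pan_deg eqxx. Qed.

Lemma pan_deg_branch (T : eqType) (u v : T) : u != v -> pan_deg u v v = 3.
Proof. by rewrite /pan_deg eq_sym eqxx => /negPf->. Qed.

Lemma pan_deg_other (T : eqType) (u v x : T) :
  x != u -> x != v -> pan_deg u v x = 2.
Proof. by rewrite /pan_deg => /negPf-> /negPf->. Qed.

Lemma sum_pan_deg (T : finType) (u v : T) :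
  u != v -> \sum_x pan_deg u v x = 2 * #|T|.
Proof.
move=> uv; have sum_delta (a : T) : \sum_x (x == a : nat) = 1.
  by rewrite -big_mkcond big_pred1_eq.
have: \sum_x (pan_deg u v x + (x == u)) = \sum_x (2 + (x == v)).
  apply: eq_bigr => x _; rewrite /pan_deg.
  by have [->|] := eqVneq x u; rewrite ?(negPf uv) //; case: (x == v).
by rewrite !big_split /= !sum_delta sum_nat_const mulnC => /addIn.
Qed.

Lemma one_bridge_pan_deg (V : finType) (G : sgraph V) :
    connected G -> 2 < #|V| -> #|bridges G| = 1 ->
  exists u v s, [/\ G u v, simple_cycle G s, v \in s &
                    forall x, pan_deg u v x <= deg G x].
Proof.
move=> G_conn V3 /eqP/cards1P[A brA].
have bridgeA B : bridge G B = (B == A) by rewrite -in_set1 -brA inE.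
have /andP[/edgesP[a [b [Gab A_def]]] _] : bridge G A by rewrite bridgeA.
have card_A : #|A| < #|V|.
  by rewrite A_def cards2 (leq_trans _ V3) //; case: eqP.
have aA : a \in A by rewrite A_def set21.
have [v [w [vA wA Gvw]]] := connected_exit G_conn aA card_A.
have off_not_bridge x y :
    (x \notin A) || (y \notin A) -> ~~ bridge G [set x; y].
  by rewrite bridgeA; apply: contraL => /eqP<-; rewrite set21 set22.
have [u Guv A_uv] : exists2 u, G u v & A = [set u; v].
  move: vA; rewrite A_def !inE => /orP[]/eqP->; last by exists a.
  by exists b; rewrite 1?adj_sym // setUC.
have vw_not_bridge : ~~ bridge G [set v; w].
  by apply: off_not_bridge; rewrite wA orbT.
have [s [s_cycle vs _]] := not_bridge_cycle G_conn Gvw vw_not_bridge.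
exists u, v, s; split=> // x.
have [->|xu] := eqVneq x u; first by rewrite pan_deg_pendant (deg_gt0 Guv).
have [->|xv] := eqVneq x v.
  rewrite pan_deg_branch ?(adj_neq Guv) //.
  apply: bridge_not_bridge_deg_gt2 Gvw vw_not_bridge => //.
  by rewrite bridgeA A_uv setUC.
have xA : x \notin A by rewrite A_uv !inE negb_or xu.
have [|_ [y [/set1P-> _ Gxy]]] := connected_exit G_conn (set11 x).
  by rewrite cards1 ltnW.
rewrite pan_deg_other //; apply: (not_bridge_deg_gt1 G_conn Gxy).
by rewrite off_not_bridge ?xA.
Qed.

Section PanDegrees.

Variables (V : finType) (G : sgraph V) (u v : V).
Hypotheses (Guv : G u v) (deg_ge : forall x, pan_deg u v x <= deg G x).

Lemma card_edges_leqif :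
  #|V| <= #|edges G| ?= iff [forall x, pan_deg u v x == deg G x].
Proof.
have := leqif_sum (fun x (_ : true) => leqif_eq (deg_ge x)).
rewrite sum_pan_deg ?(adj_neq Guv) // sum_deg => -[].
by rewrite leq_mul2l eqn_mul2l => ? ?; split.
Qed.

Lemma card_edges_eq_deg x : #|edges G| = #|V| -> deg G x = pan_deg u v x.
Proof. by move/esym/eqP; rewrite card_edges_leqif => /forallP/(_ x)/eqP. Qed.

Lemma branch_deg_gt2 : 2 < deg G v.
Proof. by have := deg_ge v; rewrite pan_deg_branch ?(adj_neq Guv). Qed.

(* Even x = u is allowed: it then has both y and v as neighbors. *)
Lemma edge_off_deg_gt1 x y : G x y -> x != v -> y != v -> 1 < deg G x.
Proof.
move=> Gxy xv yv; have [x_def|xu] := eqVneq x u; last first.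
  by have := deg_ge x; rewrite pan_deg_other.
rewrite {}x_def in Gxy *; have vy_nbrs : [set v; y] \subset neighbors G u.
  by rewrite subUset !sub1set !in_neighbors Guv.
by have := subset_leq_card vy_nbrs; rewrite cards2 eq_sym yv.
Qed.

End PanDegrees.

Section PanIso.

Variables (V : finType) (G : sgraph V) (u v : V) (s : seq V).
Hypotheses (G_conn : connected G) (Guv : G u v).
Hypothesis deg_pan : forall x, deg G x = pan_deg u v x.
Hypotheses (s_cycle : simple_cycle G s) (vs : v \in s).

Lemma pendant_notin_cycle : u \notin s.
Proof.
apply/negP=> us; have := subset_leq_card (cycle_neighbors s_cycle us).
rewrite (card_cycle_neighbors s_cycle us) card_neighbors deg_pan.
by rewrite pan_deg_pendant.
Qed.

Lemma pan_cycle_span : u |: [set x in s] = setT.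
Proof.
apply: (connected_closed G_conn (setU11 u _)) => x y Gxy; rewrite !inE.
have deg_u : deg G u = 1 by rewrite deg_pan pan_deg_pendant.
case/predU1P=> [x_def|xs].
  by rewrite x_def in Gxy; rewrite (pendant_adj deg_u Gxy Guv) vs orbT.
have yN : y \in neighbors G x by rewrite in_neighbors.
have nbrs_s : {subset [set next s x; prev s x] <= s}.
  by move=> z; rewrite !inE => /orP[]/eqP->; rewrite ?mem_next ?mem_prev.
have xu : x != u by apply: contraNneq pendant_notin_cycle => <-.
have [x_def|xv] := eqVneq x v; last first.
  rewrite (neighbors_eq (cycle_neighbors s_cycle xs)) in yN.
    by rewrite nbrs_s ?orbT.
  by rewrite (card_cycle_neighbors s_cycle xs) deg_pan pan_deg_other.
have u_cycle_nbrs : u |: [set next s x; prev s x] \subset neighbors G x.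
  by rewrite subUset sub1set in_neighbors cycle_neighbors // x_def adj_sym Guv.
have u_nbrs : u \notin [set next s x; prev s x].
  by apply: contra pendant_notin_cycle => /nbrs_s.
rewrite (neighbors_eq u_cycle_nbrs) in yN.
  by case/setU1P: yN => [->|/nbrs_s->]; rewrite ?eqxx ?orbT.
rewrite cardsU1 u_nbrs (card_cycle_neighbors s_cycle xs) deg_pan x_def.
by rewrite pan_deg_branch ?(adj_neq Guv).
Qed.

Lemma card_pan_cycle : #|V| = (size s).+1.
Proof.
rewrite -cardsT -pan_cycle_span cardsU1 inE pendant_notin_cycle cardsE.
by have /and3P[/card_uniqP->] := s_cycle.
Qed.

Lemma pan_iso : graph_iso G (P1 #|V|).
Proof.
have [i p s_def] := rot_to vs; have [s_uniq s_adj s_size] := and3P s_cycle.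
have size_rot_s : (#|V|).-2.+1 = size (rot i s).
  by rewrite card_pan_cycle size_rot; case: (size s) s_size.
have V3 : 3 < #|V| by rewrite card_pan_cycle.
pose f (o : option 'I_#|V|.-2.+1) :=
  if o is Some j then nth v (rot i s) j else u.
have ltj (j : 'I_#|V|.-2.+1) : j < size (rot i s) by rewrite -size_rot_s.
have nth_neq_u (j : 'I_#|V|.-2.+1) : nth v (rot i s) j != u.
  apply: contraNneq pendant_notin_cycle => <-.
  by rewrite -(mem_rot i) mem_nth.
apply: graph_iso_sym; apply: (@bij_hom_iso _ _ _ _ f).
- move=> [j|] [k|] //= => [/eqP|/eqP|/esym/eqP];
    rewrite ?(negPf (nth_neq_u _)) //.
  by rewrite nth_uniq ?rot_uniq // => /eqP/val_inj->.
- have Gv0 : nth v (rot i s) 0 = v by rewrite s_def.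
  move=> [j|] [k|] //= => [jk|/eqP->|/eqP->].
  + by apply: cycle_graph_hom jk; rewrite ?rot_cycle.
  + by rewrite Gv0 adj_sym.
  + by rewrite Gv0.
- by rewrite card_option card_ord; lia.
- rewrite card_edges_P1 // -(leq_pmul2l (m := 2)) // -sum_deg.
  by under eq_bigr do rewrite deg_pan; rewrite sum_pan_deg ?(adj_neq Guv).
Qed.

End PanIso.

Local Open Scope ring_scope.

Section Sombor.

Variables (R : rcfType) (V : finType) (G : sgraph V).
Implicit Types (x y : V) (A : {set V}).

Definition edge_weight A : R := Num.sqrt (\sum_(x in A) (deg G x)%:R ^+ 2).

Lemma edge_weight_set2 x y : G x y ->
  edge_weight [set x; y] = Num.sqrt (deg G x ^ 2 + deg G y ^ 2)%N%:R.
Proof. by move=> Gxy; rewrite /edge_weight edge_weightE // natrD !natrX. Qed.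

Lemma edge_weight_ge x y a b : G x y -> (a <= deg G x)%N -> (b <= deg G y)%N ->
  Num.sqrt (a ^ 2 + b ^ 2)%N%:R <= edge_weight [set x; y].
Proof.
move=> Gxy ax yb; rewrite edge_weight_set2 // ler_wsqrtr // ler_nat.
by rewrite leq_add // leq_sqr.
Qed.

Lemma sombor_split x y : G x y ->
  sombor R G = edge_weight [set x; y]
    + \sum_(z in neighbors G x :\ y) edge_weight [set x; z]
    + \sum_(A in [set A in edges G | x \notin A]) edge_weight A.
Proof.
move=> Gxy; rewrite /sombor (bigID (fun A : {set V} => x \in A)) /=.
rewrite big_edges_at (big_setD1 y) ?in_neighbors //=; congr (_ + _).
by apply: eq_bigl => A; rewrite !inE.
Qed.

End Sombor.

(* The Sombor index of P_n^1; see sombor_pan. *)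
Definition pan_sombor (R : rcfType) (n : nat) : R :=
  2 * (n%:R - 3) * Num.sqrt 2 + Num.sqrt 10 + 2 * Num.sqrt 13.

Lemma ler_pan_sombor (R : rcfType) :
  {mono pan_sombor R : m n / (m <= n)%N >-> m <= n}.
Proof.
move=> m n; rewrite /pan_sombor !lerD2r ler_pM2r ?sqrtr_gt0 // ler_pM2l //.
by rewrite lerD2r ler_nat.
Qed.

Lemma sqrt8 (R : rcfType) : Num.sqrt 8 = 2 * Num.sqrt 2 :> R.
Proof.
have -> : 8 = 2 ^+ 2 * 2 :> R by ring.
by rewrite sqrtrM ?sqrtr_sqr ?normr_nat // exprn_ge0.
Qed.

Section PanSombor.

Variables (R : rcfType) (V : finType) (G : sgraph V) (u v : V).
Hypothesis Guv : G u v.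

Let Gvu : G v u. Proof. by rewrite adj_sym. Qed.

Lemma sombor_pan :
  (forall x, deg G x = pan_deg u v x) -> sombor R G = pan_sombor R #|edges G|.
Proof.
move=> deg_pan; have deg_u : deg G u = 1%N by rewrite deg_pan pan_deg_pendant.
have deg_v : deg G v = 3%N by rewrite deg_pan pan_deg_branch ?(adj_neq Guv).
have deg_off x y : G x y -> x != v -> y != v -> deg G x = 2%N.
  move=> Gxy xv yv; rewrite deg_pan pan_deg_other //.
  apply: contraNneq yv => x_def; rewrite x_def in Gxy.
  by rewrite (pendant_adj deg_u Gxy Guv).
have w_u : edge_weight R G [set v; u] = Num.sqrt 10.
  by rewrite edge_weight_set2 // deg_u deg_v.
have w_nbrs y : y \in neighbors G v :\ u ->
    edge_weight R G [set v; y] = Num.sqrt 13.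
  case/setD1P=> yu; rewrite in_neighbors => Gvy.
  rewrite edge_weight_set2 // deg_v deg_pan pan_deg_other //.
  by rewrite eq_sym (adj_neq Gvy).
have w_off A : A \in [set A in edges G | v \notin A] ->
    edge_weight R G A = Num.sqrt 8.
  case/edges_offP=> x [y [Gxy xv yv ->]].
  by rewrite edge_weight_set2 // (deg_off x y) // (deg_off y x) // adj_sym.
have card_nbrs : #|neighbors G v :\ u| = 2%N.
  by move: deg_v; rewrite -card_neighbors (cardsD1 u) in_neighbors Gvu => -[].
rewrite (sombor_split R Gvu) (eq_bigr _ w_nbrs) (eq_bigr _ w_off) !sumr_const.
rewrite w_u card_edges_off card_nbrs -[_ *+ (_ - _)]mulr_natl natrB; last first.
  exact: leq_deg_card_edges.
by rewrite deg_v /pan_sombor sqrt8; ring.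
Qed.

Hypothesis deg_ge : forall x, (pan_deg u v x <= deg G x)%N.

Lemma sombor_ge_pan : pan_sombor R #|edges G| <= sombor R G.
Proof.
have deg_v := branch_deg_gt2 Guv deg_ge.
have w_u : Num.sqrt 10 <= edge_weight R G [set v; u].
  exact: (@edge_weight_ge R V G v u 3 1 Gvu deg_v (deg_gt0 Guv)).
have w_nbrs : (deg G v).-1%:R * Num.sqrt 13
    <= \sum_(y in neighbors G v :\ u) edge_weight R G [set v; y].
  have <- : #|neighbors G v :\ u| = (deg G v).-1.
    by rewrite -card_neighbors (cardsD1 u (neighbors _ _)) in_neighbors Gvu.
  rewrite mulr_natl -sumr_const; apply: ler_sum => y /setD1P[yu].
  rewrite in_neighbors => Gvy; apply: (@edge_weight_ge R V G v y 3 2 Gvy deg_v).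
  by rewrite (leq_trans _ (deg_ge y)) // pan_deg_other // eq_sym (adj_neq Gvy).
have w_off : (#|edges G| - deg G v)%N%:R * Num.sqrt 8
    <= \sum_(A in [set A in edges G | v \notin A]) edge_weight R G A.
  rewrite mulr_natl -card_edges_off -sumr_const; apply: ler_sum => A.
  case/edges_offP=> x [y [Gxy xv yv ->]].
  apply: (@edge_weight_ge R V G x y 2 2 Gxy).
    exact: (edge_off_deg_gt1 Guv deg_ge Gxy xv yv).
  by apply: (edge_off_deg_gt1 Guv deg_ge _ yv xv); rewrite adj_sym.
rewrite (sombor_split R Gvu); apply: le_trans (lerD (lerD w_u w_nbrs) w_off).
rewrite -subn1 !natrB ?leq_deg_card_edges ?(deg_gt0 Gvu) // -subr_ge0.
rewrite (_ : _ - _ = ((deg G v)%:R - 3) * (Num.sqrt 13 - Num.sqrt 8)).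
  by rewrite mulr_ge0 ?subr_ge0 ?ler_wsqrtr ?ler_nat.
by rewrite /pan_sombor sqrt8; ring.
Qed.

Lemma sombor_leif : pan_sombor R #|V| <= sombor R G ?= iff (#|edges G| == #|V|).
Proof.
have [geE _] := card_edges_leqif Guv deg_ge; split.
  by rewrite (le_trans _ sombor_ge_pan) ?ler_pan_sombor.
apply/eqP/eqP => [eq_sombor|eqE].
  apply/eqP; rewrite eqn_leq geE andbT.
  by rewrite -(ler_pan_sombor R) eq_sombor sombor_ge_pan.
by rewrite sombor_pan ?eqE // => x; apply: card_edges_eq_deg.
Qed.

End PanSombor.

Theorem theorem4p2 (R : rcfType) (n : nat) (V : finType) (G : sgraph V)
    (hn : (4 <= n)%N) (hV : #|V| = n) (hconn : connected G)
    (hbridge : #|bridges G| = 1%N) :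
  let b : R := 2 * (n%:R - 3) * Num.sqrt 2 + Num.sqrt 10 + 2 * Num.sqrt 13 in
  b <= sombor R G /\ (sombor R G = b <-> graph_iso G (P1 n)).
Proof.
rewrite -/(pan_sombor R n) /=; subst n.
have [u [v [s [Guv s_cycle vs deg_ge]]]] :=
  one_bridge_pan_deg hconn (ltnW hn) hbridge.
have [le_sombor eq_sombor] := sombor_leif R Guv deg_ge.
split=> //; split=> [/esym/eqP|iso].
  rewrite eq_sombor => /eqP eqE.
  have deg_pan x := card_edges_eq_deg Guv deg_ge x eqE.
  exact: pan_iso hconn Guv deg_pan s_cycle vs.
by apply/esym/eqP; rewrite eq_sombor (graph_iso_card_edges iso) card_edges_P1.
Qed.
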